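(* There is an absolute constant $c>0$ such that the following holds for all reals $\lambda\geq 1$ and $d>0$. Let $G$ be a graph in which $d\leq d_G(v)\leq \lambda d$ for each $v\in V(G)$. Then, for some $d'\geq cd/\lambda^3$, $G$ contains a subgraph $H$ with average degree $d'$ and maximum degree at most $d'+10^8$ such that $|H|\geq c|G|/\lambda^{10}$.
   Context: All graphs are finite and simple with non-empty vertex sets. $|G|$ denotes the number of vertices of $G$ and $d_G(v)$ the degree of $v$ in $G$. *)

(* Defs.v *)
From mathcomp Require Import all_boot all_order all_algebra.
From mathcomp Require Import reals.
Set Implicit Arguments.
Unset Strict Implicit.
Unset Printing Implicit Defensive.
Import Order.TTheory GRing.Theory Num.Theory.

(* A finite simple graph with non-empty vertex set, whose vertices lie in an
   ambient finite type T, so that a graph and its subgraphs have the same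
   type. *)
Record sgraph (T : finType) := SGraph {
  vset : {set T};
  adj : rel T;
  adj_sym : symmetric adj;
  adj_irr : irreflexive adj;
  adj_vset : forall x y : T, adj x y -> x \in vset;
  vset_neq0 : vset != set0
}.

Definition degree (T : finType) (G : sgraph T) (v : T) : nat :=
  #|[set w | adj G v w]|.

Definition max_degree (T : finType) (G : sgraph T) : nat :=
  \max_(v in vset G) degree G v.

Definition avg_degree (R : realType) (T : finType) (G : sgraph T) : R :=
  ((\sum_(v in vset G) (degree G v)%:R) / #|vset G|%:R)%R.

(* Subgraphs need not be induced or spanning. *)
Definition subgraph (T : finType) (H G : sgraph T) : Prop :=
  vset H \subset vset G /\ (forall x y : T, adj H x y -> adj G x y).

(* Main.v *)
(* Allow fractional edge weights in [0, 1]. If the weighted degrees are k * p v,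
   keep each vertex v with probability p v and divide the weight of uv by
   p u * p v: every surviving vertex has expected weighted degree k, and its
   variance is controlled by the average of 1 - p u over its neighbours. Capping
   the degrees at k then turns an average deficit D (below k) into one of order
   sqrt D, so resampling makes progress as long as D exceeds a constant.
   Starting from constant weights, with p v proportional to the degree, gives
   an initial graph whose average deficit is at most k / 20. A potential adding
   to the total deficit a charge for deleted vertices and for the growth of the
   weights shows that resampling, and deletion of vertices of small degree or
   overgrown weights, stops with average deficit O(1) before half of the
   vertices are lost and before any weight exceeds 1. Finally, weights with
   given degrees and as few fractional edges as possible have at most as many
   fractional edges as vertices, and those can be dropped. When k is bounded, a
   maximal matching suffices. *)
Require Import Defs.
From mathcomp Require Import all_boot all_order all_algebra.
From mathcomp Require Import reals sequences exp.
From mathcomp Require Import ring lra.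
Import Order.TTheory GRing.Theory Num.Theory.
Local Open Scope ring_scope.
Set Implicit Arguments.
Unset Strict Implicit.
Unset Printing Implicit Defensive.

(** * Random vertex subsets *)

Section RandomSubset.
Variables (R : realFieldType) (T : finType) (p : T -> R).
Hypothesis p01 : forall v, 0 <= p v <= 1.

Definition subset_prob (A : {set T}) : R :=
  \prod_v (if v \in A then p v else 1 - p v).

Lemma subset_prob_ge0 A : 0 <= subset_prob A.
Proof.
by apply: prodr_ge0 => v _; have /andP[p0 p1] := p01 v; case: ifP => _; lra.
Qed.

Lemma expect_subset (B : {set T}) :
  \sum_A subset_prob A * (B \subset A)%:R = \prod_(v in B) p v.
Proof.
transitivity (\sum_(A : {set T}) \prod_v
   (if v \in A then p v else if v \in B then 0 else 1 - p v)).
  apply: eq_bigr => A _; have [sBA|/subsetPn[v vB vA]] := boolP (B \subset A).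
    rewrite mulr1; apply: eq_bigr => v _; case: ifPn => // vA.
    by rewrite ifN //; apply: contra vA => /(subsetP sBA).
  by rewrite mulr0 (bigD1 v) //= (negPf vA) vB mul0r.
rewrite -bigA_distr [RHS]big_mkcond; apply: eq_bigr => v _.
by case: ifP => _ /=; rewrite ?addr0 // addrC subrK.
Qed.

Lemma expect1 : \sum_A subset_prob A = 1.
Proof.
have <- : \prod_(v in set0) p v = 1 by rewrite big_set0.
rewrite -expect_subset.
by apply: eq_bigr => A _; rewrite sub0set mulr1.
Qed.

Lemma expect_mem v : \sum_A subset_prob A * (v \in A)%:R = p v.
Proof.
have <- : \prod_(u in [set v]) p u = p v by rewrite big_set1.
rewrite -expect_subset.
by apply: eq_bigr => A _; rewrite sub1set.
Qed.

Lemma expect_mem2 u v : u != v ->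
  \sum_A subset_prob A * ((u \in A)%:R * (v \in A)%:R) = p u * p v.
Proof.
move=> uv.
have <- : \prod_(x in [set u; v]) p x = p u * p v.
  by rewrite big_setU1 ?inE //= big_set1.
rewrite -expect_subset.
by apply: eq_bigr => A _; rewrite subUset !sub1set -natrM mulnb.
Qed.

Lemma expect_mem3 u v w : u != v -> u != w -> v != w ->
  \sum_A subset_prob A * ((u \in A)%:R * (v \in A)%:R * (w \in A)%:R)
  = p u * p v * p w.
Proof.
move=> uv uw vw.
have <- : \prod_(x in u |: [set v; w]) p x = p u * p v * p w.
  by rewrite !big_setU1 ?inE ?negb_or ?uv //= big_set1 mulrA.
rewrite -expect_subset.
by apply: eq_bigr => A _; rewrite !subUset !sub1set -!natrM !mulnb andbA.
Qed.

Lemma expect_cov v u u' : v != u -> v != u' ->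
  \sum_A subset_prob A *
    ((v \in A)%:R * (((u \in A)%:R - p u) * ((u' \in A)%:R - p u')))
  = if u == u' then p v * (p u * (1 - p u)) else 0.
Proof.
move=> vu vu'; have [<-|uu'] := eqVneq u u'.
  transitivity (\sum_A ((1 - 2 * p u) *
     (subset_prob A * ((v \in A)%:R * (u \in A)%:R)) +
     p u ^+ 2 * (subset_prob A * (v \in A)%:R))).
    by apply: eq_bigr => A _; case: (u \in A) => /=; ring.
  rewrite big_split /= -!mulr_sumr expect_mem2 // expect_mem; ring.
transitivity (\sum_A (
   (subset_prob A * ((v \in A)%:R * (u \in A)%:R * (u' \in A)%:R)
   + p u * p u' * (subset_prob A * (v \in A)%:R))
   - (p u' * (subset_prob A * ((v \in A)%:R * (u \in A)%:R))
   + p u * (subset_prob A * ((v \in A)%:R * (u' \in A)%:R))))).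
  by apply: eq_bigr => A _; ring.
rewrite sumrB !big_split /= -!mulr_sumr expect_mem3 // !expect_mem2 //.
by rewrite expect_mem; ring.
Qed.

Lemma expect_sqr v (h : T -> R) : h v = 0 ->
  \sum_A subset_prob A *
    ((v \in A)%:R * (\sum_u h u * ((u \in A)%:R - p u)) ^+ 2)
  = p v * \sum_u h u ^+ 2 * (p u * (1 - p u)).
Proof.
move=> hv.
transitivity (\sum_u \sum_u' \sum_A h u * h u' * (subset_prob A *
    ((v \in A)%:R * (((u \in A)%:R - p u) * ((u' \in A)%:R - p u'))))).
  transitivity (\sum_A \sum_u \sum_u' h u * h u' * (subset_prob A *
    ((v \in A)%:R * (((u \in A)%:R - p u) * ((u' \in A)%:R - p u'))))).
    apply: eq_bigr => A _; rewrite expr2 big_distrl /= !mulr_sumr.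
    apply: eq_bigr => u _; rewrite mulr_sumr !mulr_sumr.
    by apply: eq_bigr => u' _; ring.
  rewrite exchange_big; apply: eq_bigr => u _; exact: exchange_big.
rewrite mulr_sumr; apply: eq_bigr => u _.
have [->|hu] := eqVneq (h u) 0.
  rewrite big1 => [|u' _]; first by ring.
  by rewrite big1 // => A _; ring.
have vu : v != u by apply: contraNneq hu => <-; rewrite hv.
rewrite (bigD1 u) //= [X in _ + X]big1 ?addr0 => [|u' u'u].
  by rewrite -mulr_sumr expect_cov // eqxx; ring.
rewrite -mulr_sumr; have [->|hu'] := eqVneq (h u') 0; first by ring.
have vu' : v != u' by apply: contraNneq hu' => <-; rewrite hv.
by rewrite expect_cov // eq_sym (negPf u'u) mulr0.
Qed.

Lemma expect_exists (F : {set T} -> R) c :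
  \sum_A subset_prob A * F A <= c ->
  exists A : {set T}, (forall v, v \in A -> p v != 0) /\ F A <= c.
Proof.
move=> Fc; pose Q A := subset_prob A != 0.
have [A QA FA] : exists2 A, Q A & F A <= c.
  have [/existsP[A /andP[]]|/existsPn nF] := boolP [exists A, Q A && (F A <=
    c)].
    by exists A.
  have := Fc; rewrite -[c in _ <= c]mul1r -expect1 mulr_suml leNgt => /negP[].
  have [A QA] : exists A, Q A.
    have [/existsP//|/existsPn Q0] := boolP [exists A, Q A]; have := expect1.
    rewrite big1 => [/eqP|A _]; first by rewrite eq_sym oner_eq0.
    by have := Q0 A; rewrite negbK => /eqP.
  rewrite (bigD1 A) //= [ltRHS](bigD1 A) //=; apply: ltr_leD.
    have pA : 0 < subset_prob A by rewrite lt_def -/(Q A) QA subset_prob_ge0.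
    by have := nF A; rewrite QA /= -ltNge ltr_pM2l.
  apply: ler_sum => B _; have [QB|] := boolP (Q B).
    apply: ler_wpM2l; first exact: subset_prob_ge0.
    by have := nF B; rewrite QB /= -ltNge => /ltW.
  by rewrite negbK => /eqP ->; rewrite !mul0r.
exists A; split=> // v vA; apply: contraNneq QA => pv.
by rewrite /subset_prob (bigD1 v) //= vA pv mul0r.
Qed.

End RandomSubset.

Section Sampling.
Variables (R : realFieldType) (T : finType).
Implicit Types (g w : T -> T -> R).

Lemma cap_degrees g (A : {set T}) (k : R) : 0 < k ->
  (forall u v, g u v = g v u) -> (forall u v, 0 <= g u v) ->
  exists w, [/\ forall u v, w u v = w v u, forall u v, 0 <= w u v <= g u v,
    forall u v, w u v != 0 -> (u \in A) && (v \in A),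
    forall v, \sum_u w v u <= k
  & \sum_(v in A) (k - \sum_u w v u) <=
    \sum_(v in A) `|\sum_(u in A) g v u - k|].
Proof.
move=> k0 gC g0; pose X v := \sum_(u in A) g v u.
have X0 v : 0 <= X v by apply: sumr_ge0.
pose c v := if X v <= k then 1 else k / X v.
have c01 v : 0 <= c v <= 1.
  rewrite /c; case: (lerP (X v) k) => Xk; first lra.
  have Xp := lt_trans k0 Xk.
  by rewrite ler_pdivrMr // mul1r (ltW Xk) andbT divr_ge0 // ltW.
have cX v : c v * X v <= k.
  rewrite /c; case: (lerP (X v) k) => Xk; first by rewrite mul1r.
  by rewrite divfK // gt_eqF // (lt_trans k0 Xk).
have loss v : k - X v + 2 * ((1 - c v) * X v) = `|X v - k|.
  rewrite /c; case: (lerP (X v) k) => Xk.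
    by ring.
  rewrite mulrBl divfK; first by ring.
  by rewrite gt_eqF // (lt_trans k0 Xk).
pose w u v := if (u \in A) && (v \in A) then g u v * (c u * c v) else 0.
have cc u v : 0 <= c u * c v <= 1.
  have /andP[a0 a1] := c01 u; have /andP[b0 b1] := c01 v.
  by rewrite mulr_ge0 //= mulr_ile1.
exists w; split.
- by move=> u v; rewrite /w andbC gC [c u * _]mulrC.
- move=> u v; rewrite /w; have /andP[h0 h1] := cc u v.
  by case: ifP => _; rewrite ?lexx ?g0 // mulr_ge0 //= ler_piMr.
- by move=> u v; rewrite /w; case: ifP => //; rewrite eqxx.
- move=> v; have /andP[cv0 cv1] := c01 v.
  apply: le_trans (cX v); rewrite /w /X mulr_sumr [leRHS]big_mkcond.
  apply: ler_sum => u _; have /andP[cu0 cu1] := c01 u.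
  case: (u \in A); rewrite ?andbF // andbT; case: ifP => _;
    last exact: mulr_ge0.
  by rewrite mulrC; apply: ler_wpM2r => //; exact: ler_piMr.
rewrite [leRHS](eq_bigr (fun v => k - X v + 2 * ((1 - c v) * X v))) => [|v _];
  last by rewrite loss.
rewrite [leRHS]big_split /= !sumrB -addrA lerD2l.
rewrite lerNl opprD opprK -mulr_sumr.
have ->: \sum_(v in A) \sum_u w v u =
    \sum_(v in A) \sum_(u in A) g v u * (c v * c u).
  apply: eq_bigr => v vA; rewrite [RHS]big_mkcond; apply: eq_bigr => u _.
  by rewrite /w vA.
have half : \sum_(v in A) (1 - c v) * X v =
    \sum_(v in A) \sum_(u in A) g v u * (1 - c v).
  by apply: eq_bigr => v _; rewrite mulrC mulr_suml.
have half' : \sum_(v in A) (1 - c v) * X v =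
    \sum_(v in A) \sum_(u in A) g v u * (1 - c u).
  rewrite half exchange_big /=; apply: eq_bigr => v _.
  by apply: eq_bigr => u _; rewrite gC.
rewrite mulr2n mulrDl mul1r {1}half half' opprD addrA -!sumrB.
apply: ler_sum => v _; rewrite -!sumrB; apply: ler_sum => u _.
have /andP[cv0 cv1] := c01 v; have /andP[cu0 cu1] := c01 u.
rewrite -{1}[g v u]mulr1 -!mulrBr; apply: ler_wpM2l => //.
have : 0 <= (1 - c v) * (1 - c u) by rewrite mulr_ge0 ?subr_ge0.
by rewrite mulrBl !mulrBr; lra.
Qed.

(* Keep v with probability p v and divide the weight of uv by p u * p v: a
   surviving vertex then has expected degree k, and the variance is small
   because it only comes from neighbours with p u < 1. *)
Lemma sampling w (p q : T -> R) (k M t : R) : 0 < k -> 0 < t ->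
  (forall u v, w u v = w v u) -> (forall v, w v v = 0) ->
  (forall u v, 0 <= w u v <= M * (p u * p v)) ->
  (forall v, 0 <= p v <= 1) -> (forall v, \sum_u w v u = k * p v) ->
  exists (A : {set T}) w', [/\ forall v, v \in A -> p v != 0,
    forall u v, w' u v = w' v u,
    forall u v, 0 <= w' u v <= w u v / (p u * p v),
    forall u v, w' u v != 0 -> (u \in A) && (v \in A)
  & (forall v, \sum_u w' v u <= k) /\
    \sum_(v in A) (k - \sum_u w' v u + q v) <=
    \sum_v (M / (2 * t) * (k * p v * (1 - p v)) + p v * (t / 2 + q v))].
Proof.
move=> k0 t0 wC w0 wM p01 wk; pose g u v := w u v / (p u * p v).
have p0 v : 0 <= p v by case/andP: (p01 v).
have wp0 u v : p v = 0 -> w u v = 0.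
  by move=> pv; apply/eqP; rewrite eq_le andbC; have := wM u v;
    rewrite pv !mulr0.
have gC u v : g u v = g v u by rewrite /g wC [p u * _]mulrC.
have g0 u v : 0 <= g u v.
  by rewrite divr_ge0 ?mulr_ge0 //; case/andP: (wM u v).
have gp u v : p u * p v * g u v = w u v.
  rewrite /g; have [pv|pv] := eqVneq (p v) 0;
    first by rewrite wp0 // pv !mulr0 mul0r.
  have [pu|pu] := eqVneq (p u) 0; first by rewrite wC wp0 // pu !mul0r.
  by field; rewrite pu pv.
have gM u v : p u * p v != 0 -> g u v <= M.
  move=> puv; rewrite ler_pdivrMr; first by case/andP: (wM u v).
  by rewrite lt_def puv mulr_ge0.
have pg v : p v != 0 -> \sum_u g v u * p u = k.
  move=> pv; apply: (mulfI pv); rewrite mulr_sumr [RHS]mulrC -wk.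
  by apply: eq_bigr => u _; rewrite -gp; ring.
pose X (A : {set T}) v := \sum_(u in A) g v u.
have dev (A : {set T}) v : p v != 0 ->
    X A v - k = \sum_u g v u * ((u \in A)%:R - p u).
  move=> pv; rewrite -(pg _ pv) /X big_mkcond -sumrB; apply: eq_bigr => u _.
  by case: (u \in A); rewrite mulrBr ?mulr1 // mulr0.
have [|A [Ap FA]] := @expect_exists _ _ p p01
    (fun A => \sum_(v in A) (`|X A v - k| + q v))
    (\sum_v (M / (2 * t) * (k * p v * (1 - p v)) + p v * (t / 2 + q v))).
  apply: le_trans (_ : \sum_v \sum_A ((2 * t)^-1 * (subset_prob p A *
    ((v \in A)%:R * (\sum_u g v u * ((u \in A)%:R - p u)) ^+ 2)) +
    (t / 2 + q v) * (subset_prob p A * (v \in A)%:R)) <= _).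
    rewrite exchange_big; apply: ler_sum => A _ /=.
    rewrite mulr_sumr big_mkcond; apply: ler_sum => v _.
    case: ifP => vA; last by rewrite !(mulr0, mul0r) addr0.
    have [pv|pv] := eqVneq (p v) 0.
      have -> : subset_prob p A = 0 by rewrite /subset_prob (bigD1 v) //= vA pv
        mul0r.
      by rewrite !mul0r !mulr0 addr0.
    rewrite -dev // [leRHS](_ : _ = subset_prob p A *
      ((2 * t)^-1 * (X A v - k) ^+ 2 + (t / 2 + q v))); last by rewrite /=;
        ring.
    apply: ler_wpM2l; first exact: subset_prob_ge0.
    rewrite addrA lerD2r; set x := X A v - k.
    rewrite -(ler_pM2l (_ : 0 < 2 * t)) ?mulr_gt0 // mulrDr mulrA divff ?mul1r;
      last first.
      by rewrite mulf_neq0 ?gt_eqF.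
    have -> : 2 * t * (t / 2) = t ^+ 2 by field.
    rewrite -[x ^+ 2]real_normK ?num_real //.
    by have := sqr_ge0 (`|x| - t); rewrite sqrrB mulr2n; lra.
  under eq_bigr => v _ do
    rewrite big_split /= -!mulr_sumr expect_mem expect_sqr ?/g ?w0 ?mul0r //.
  rewrite !big_split /= lerD //; last by apply: ler_sum => v _; rewrite mulrC.
  rewrite -mulr_sumr [leRHS](_ : _ = (2 * t)^-1 *
     (M * \sum_v k * p v * (1 - p v))); last first.
    by rewrite -!mulr_sumr; ring.
  apply: ler_wpM2l; first by rewrite invr_ge0 mulr_ge0 ?ltW.
  have -> : \sum_v k * p v * (1 - p v) = \sum_v \sum_u w u v * (1 - p u).
    rewrite exchange_big; apply: eq_bigr => v _.
    by rewrite -wk mulr_suml.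
  rewrite mulr_sumr; apply: ler_sum => v _.
  rewrite !mulr_sumr; apply: ler_sum => u _; rewrite -/(g v u).
  rewrite [w u v]wC -gp; have [puv|puv] := eqVneq (p v * p u) 0.
    by move/eqP: puv; rewrite mulf_eq0 => /orP[]/eqP->; rewrite !(mul0r, mulr0).
  rewrite [leLHS](_ : _ = g v u * (p v * p u * (1 - p u)) * g v u);
    last by ring.
  rewrite [leRHS](_ : _ = g v u * (p v * p u * (1 - p u)) * M); last by ring.
  apply: ler_wpM2l; last exact: gM.
  by rewrite mulr_ge0 ?g0 // !mulr_ge0 //; have /andP[] := p01 u; lra.
have [w' [w'C w'g w'A w'k w'D]] := cap_degrees A k0 gC g0.
exists A, w'; split=> //; split=> //; apply: le_trans FA.
by rewrite [leLHS]big_split [leRHS]big_split /= lerD2r.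
Qed.

End Sampling.

(** * Reducing the deficit *)

Section Descent.
Variables (R : realType) (T : finType) (e : rel T) (k m : R).
Hypotheses (eirr : irreflexive e) (k_ge10 : 10 <= k) (m_ge0 : 0 <= m).
Hypothesis m_small : m * expR 16 <= 9^-1.
Implicit Types (V : {set T}) (w : T -> T -> R) (a : T -> R).

(* The exponent a v records how much the weights at v may have grown. *)
Definition capped_weights V w a := [/\ forall u v, w u v = w v u,
  forall u v, 0 <= w u v <= m * expR (a u + a v),
  forall u v, w u v != 0 -> [/\ u \in V, v \in V & e u v],
  forall v, \sum_u w v u <= k & forall v, v \in V -> 0 <= a v].

Definition deficit V w := \sum_(v in V) (k - \sum_u w v u).

(* The last two terms charge k/4 for every unit of growth and k/10 for every
   deleted vertex, up to an additive constant. *)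
Definition potential V w a :=
  \sum_(v in V) (k - \sum_u w v u + (k / 4 * a v - k / 10)).

Lemma delete_vertex V w a v : capped_weights V w a -> v \in V ->
  \sum_u w v u < k / 3 \/ 8 <= a v ->
  exists w', capped_weights (V :\ v) w' a /\
    potential (V :\ v) w' a <= potential V w a - 1.
Proof.
move=> [wC wM wV wk a0] vV bad; have k10 := k_ge10.
pose w' x y := if (x == v) || (y == v) then 0 else w x y.
have w0 x y : 0 <= w x y by case/andP: (wM x y).
have w'w x y : 0 <= w' x y <= w x y.
  by rewrite /w'; case: ifP; rewrite ?lexx ?w0.
exists w'; split.
  split.
  - by move=> x y; rewrite /w' orbC wC.
  - move=> x y; have /andP[-> le1] := w'w x y.
    by have /andP[_ le2] := wM x y; exact: le_trans le2.
  - move=> x y; rewrite /w'; case: ifPn => [_|]; first by rewrite eqxx.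
    by rewrite negb_or => /andP[xv yv] /wV[xV yV exy]; rewrite !inE xv yv.
  - by move=> x; apply: le_trans (wk x); apply: ler_sum => y _;
    case/andP: (w'w x y).
  - by move=> x; rewrite !inE => /andP[_]; exact: a0.
have deg' x : x != v -> \sum_u w' x u = \sum_u w x u - w x v.
  move=> xv; rewrite [X in _ = X - _](bigD1 v) //= addrAC subrr add0r.
  rewrite (bigD1 v) //= {1}/w' eqxx orbT add0r.
  by apply: eq_bigr => y yv; rewrite /w' (negPf xv) (negPf yv).
rewrite /potential (big_setD1 v vV) /=.
rewrite (eq_bigr (fun x => (k - \sum_u w x u + (k / 4 * a x - k / 10)) + w x
  v)); last first.
  by move=> x; rewrite !inE => /andP[xv _]; rewrite deg' //; ring.
rewrite big_split /=.
have : \sum_(x in V :\ v) w x v <= \sum_u w v u.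
  rewrite big_mkcond; apply: ler_sum => x _; case: ifP => _ //.
  by rewrite wC.
move: bad (wk v) (a0 v vV); move: (\sum_u w v u) (\sum_(x in V :\ v) w x v).
move=> d b bad dk av bd; move: (\sum_(x in _) _) => S.
case: bad => bad; last first.
  have ka : 0 <= k / 4 * (a v - 8).
    by apply: mulr_ge0; lra.
  by rewrite mulrBr in ka; lra.
have ka : 0 <= k / 4 * a v by apply: mulr_ge0; lra.
by lra.
Qed.

Lemma sample_vertices V w a : capped_weights V w a ->
  (forall v, v \in V -> k / 3 <= \sum_u w v u) ->
  (forall v, v \in V -> a v <= 8) ->
  exists V' w' a', [/\ V' \subset V, capped_weights V' w' a' &
    potential V' w' a' <= potential V w a - 2 / 5 * deficit V w + #|V|%:R].
Proof.
move=> [wC wM wV wk a0] wlow a8; pose p v := (\sum_u w v u) / k.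
have k10 := k_ge10; have k0 : 0 < k by lra.
have w0 x y : 0 <= w x y by case/andP: (wM x y).
have p01 v : 0 <= p v <= 1.
  by rewrite ler_pdivrMr // mul1r wk andbT divr_ge0 ?sumr_ge0 // ltW.
have p0 v : 0 <= p v by case/andP: (p01 v).
have plow v : v \in V -> 3^-1 <= p v.
  by move=> vV; rewrite ler_pdivlMr //; have := wlow v vV; lra.
have pk v : \sum_u w v u = k * p v.
  by rewrite mulrC divfK // gt_eqF.
have pV v : p v != 0 -> v \in V.
  apply: contraNT => vV; rewrite /p big1 ?mul0r // => u _.
  by apply/eqP; apply: contraNT vV => /wV[].
have wp u v : 0 <= w u v <= 1 * (p u * p v).
  rewrite w0 mul1r /=; have [->|/wV[uV vV _]] := eqVneq (w u v) 0.
    exact: mulr_ge0.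
  have /andP[_ /le_trans->//] := wM u v.
  apply: le_trans (_ : m * expR 16 <= _).
    rewrite ler_wpM2l // ler_expR.
    by have := a8 u uV; have := a8 v vV; lra.
  apply: le_trans m_small _.
  have -> : 9^-1 = 3^-1 * 3^-1 :> R by field.
  by rewrite ler_pM ?invr_ge0 // plow.
pose a' v := a v + ((p v)^-1 - 1).
have wvv v : w v v = 0.
  by apply/eqP; apply: contraT => /wV[_ _]; rewrite eirr.
have [A [w' [Ap w'C w'w w'A [w'k w'D]]]] :=
  sampling (fun v => k / 4 * a' v - k / 10) k0 (ltr0Sn R 1) wC wvv wp p01 pk.
have AV : A \subset V by apply/subsetP => v /Ap/pV.
exists A, w', a'; split=> //.
  split=> //.
  - move=> u v; have /andP[-> le1] := w'w u v => /=.
    have [->|/w'A/andP[/Ap pu /Ap pv]] := eqVneq (w' u v) 0.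
      by rewrite mulr_ge0 ?expR_ge0.
    apply: le_trans le1 _.
    have -> : a' u + a' v = (a u + a v) + (((p u)^-1 - 1) + ((p v)^-1 - 1)).
      by rewrite /a'; ring.
    have pp : 0 <= (p u * p v)^-1 by rewrite invr_ge0; exact: mulr_ge0.
    rewrite expRD mulrA ler_pM //.
      by case/andP: (wM u v).
    rewrite expRD invfM ler_pM ?invr_ge0 ?p0 //.
      by have := expR_ge1Dx ((p u)^-1 - 1); rewrite addrC subrK.
    by have := expR_ge1Dx ((p v)^-1 - 1); rewrite addrC subrK.
  - move=> u v w'uv; have /andP[-> ->] := w'A _ _ w'uv; split=> //.
    suff /wV[] : w u v != 0 by [].
    apply: contraNneq w'uv => wuv; have := w'w u v.
    by rewrite wuv mul0r eq_le andbC.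
  - move=> v vA; rewrite addr_ge0 ?a0 ?(subsetP AV) // subr_ge0.
    rewrite invr_ge1 ?unitfE ?Ap // ?lt_def ?Ap ?p0 //.
    by case/andP: (p01 v).
apply: le_trans w'D _.
rewrite (bigID [in V]) /= [X in _ + X]big1 ?addr0 => [|v vV]; last first.
  have -> : p v = 0 by apply/eqP; apply: contraNT vV; exact: pV.
  by ring.
rewrite /potential /deficit -sum1_card natr_sum mulr_sumr -sumrB -big_split /=.
apply: ler_sum => v vV; rewrite /a' pk; have pv := plow v vV.
have pn0 : p v != 0 by apply: lt0r_neq0; lra.
have av := a0 v vV.
have /andP[_ p1] := p01 v; move: (p v) (a v) pv pn0 p1 av => x y x3 x0 x1 y0.
have -> : x * (2 / 2 + (k / 4 * (y + (x^-1 - 1)) - k / 10)) =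
  x + k / 4 * (x * y) + k / 4 * (1 - x) - x * (k / 10).
  by field.
have h1 : 0 <= k * (1 - x) ^+ 2 by rewrite mulr_ge0 ?sqr_ge0 ?ltW.
have h2 : 0 <= k / 4 * ((1 - x) * y).
  by apply: mulr_ge0; [lra | apply: mulr_ge0; lra].
have -> : k * x * (1 - x) = k * (1 - x) - k * (1 - x) ^+ 2 by ring.
have -> : 1 / (2 * 2) = 4^-1 :> R by field.
move: h1 h2; rewrite mulrBl mul1r !mulrBr; set z := k * _ ^+ 2; lra.
Qed.

Lemma reduce_deficit V w a : capped_weights V w a ->
  exists V' w' a', [/\ V' \subset V, capped_weights V' w' a',
    forall v, v \in V' -> a' v <= 8, deficit V' w' <= 5 * #|V|%:R
    & potential V' w' a' <= potential V w a].
Proof.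
move=> st0; pose N := #|V|; have k10 := k_ge10.
have [n] : exists n : nat, potential V w a < n%:R - k / 10 * N%:R.
  exists (Num.bound `|potential V w a + k / 10 * N%:R|); rewrite ltrBrDr.
  by apply: le_lt_trans (ler_norm _) _; exact: archi_boundP.
suff gen V1 w1 a1 : potential V1 w1 a1 <= potential V w a -> V1 \subset V ->
    capped_weights V1 w1 a1 -> potential V1 w1 a1 < n%:R - k / 10 * N%:R ->
  exists V' w' a', [/\ V' \subset V, capped_weights V' w' a',
    forall v, v \in V' -> a' v <= 8, deficit V' w' <= 5 * #|V|%:R
    & potential V' w' a' <= potential V w a].
  exact: gen (lexx _) (subxx _) st0.
elim: n V1 w1 a1 => [|n IH] V1 w1 a1 n0 sV1 st1 ltn.
  have [_ _ _ wk a0] := st1; move: ltn; rewrite ltNge => /negP[].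
  apply: le_trans (_ : \sum_(v in V1) - (k / 10) <= _).
    rewrite sub0r sumr_const mulNrn lerN2 -[_ *+ #|V1|]mulr_natr ler_wpM2l
      ?ler_nat ?subset_leq_card //.
    by lra.
  rewrite /potential; apply: ler_sum => v vV; have ka : 0 <= k / 4 * a1 v.
    by apply: mulr_ge0; [lra | exact: a0].
  by have := wk v; lra.
have next V2 w2 a2 : V2 \subset V1 -> capped_weights V2 w2 a2 ->
    potential V2 w2 a2 <= potential V1 w1 a1 - 1 ->
  exists V' w' a', [/\ V' \subset V, capped_weights V' w' a',
    forall v, v \in V' -> a' v <= 8, deficit V' w' <= 5 * #|V|%:R
    & potential V' w' a' <= potential V w a].
  move=> sV2 st2 n2; apply: (IH V2 w2 a2) => //.
  - by apply: le_trans n2 _; lra.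
  - exact: subset_trans sV1.
  by move: ltn; rewrite -natr1; lra.
have [/existsP[v /andP[vV /orP bad]]|/existsPn nobad] :=
    boolP [exists v, (v \in V1) && ((\sum_u w1 v u < k / 3) || (8 <= a1 v))].
  have [w2 [st2 n2]] := delete_vertex st1 vV bad.
  by apply: (next _ _ _ _ st2 n2); exact: subsetDl.
have [small|large] := lerP (deficit V1 w1) (5 * N%:R).
  exists V1, w1, a1; split=> // v vV; have := nobad v.
  by rewrite vV negb_or -ltNge => /andP[_ /ltW].
have NV1 : #|V1|%:R <= N%:R :> R by rewrite ler_nat subset_leq_card.
have [||V2 [w2 [a2 [sV2 st2 n2]]]] := sample_vertices st1.
- by move=> v vV; have := nobad v; rewrite vV negb_or -leNgt => /andP[].
- by move=> v vV; have := nobad v; rewrite vV negb_or -ltNge => /andP[_ /ltW].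
apply: (next _ _ _ sV2 st2); apply: le_trans n2 _.
suff : 1 <= N%:R :> R by lra.
rewrite ler1n lt0n cards_eq0; apply: contraTneq large => V0.
rewrite /N /deficit; have -> : V1 = set0.
  by apply/eqP; rewrite -subset0 -V0.
by rewrite big_set0 V0 cards0 mulr0 ltxx.
Qed.

End Descent.

(** * Rounding *)

Lemma exists_dependency (F : fieldType) (E S : finType) (a : E -> S -> F) :
  (#|S| < #|E|)%N ->
  exists x : E -> F,
    (exists e, x e != 0) /\ (forall s, \sum_e x e * a e s = 0).
Proof.
move=> SE; pose M := \matrix_(i < #|E|, j < #|S|) a (enum_val i) (enum_val j).
have : kermx M != 0.
  rewrite -mxrank_eq0 mxrank_ker subn_eq0 -ltnNge.
  exact: leq_ltn_trans (rank_leq_col M) SE.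
case/rowV0Pn => y /sub_kermxP yM y0.
exists (fun e => y 0 (enum_rank e)); split.
  by have /rV0Pn[i yi] := y0; exists (enum_val i); rewrite enum_valK.
move=> s; have /rowP/(_ (enum_rank s)) := yM; rewrite !mxE => yMs.
rewrite -[RHS]yMs (reindex_onto enum_rank enum_val) => [|i _];
  last exact: enum_valK.
apply: eq_big => [e|e _]; first by rewrite enum_rankK eqxx.
by rewrite !mxE !enum_rankK.
Qed.

Section Rounding.
Variables (R : realFieldType) (T : finType) (V : {set T}).
Implicit Type w : T -> T -> R.

Definition fractional w : {set T * T} :=
  [set e | (0 < w e.1 e.2) && (w e.1 e.2 < 1)].

Lemma fractional_reduce w :
  (forall u v, w u v = w v u) -> (forall v, w v v = 0) ->
  (forall u v, 0 <= w u v <= 1) -> (forall u v, w u v != 0 -> u \in V) ->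
  (2 * #|V| < #|fractional w|)%N ->
  exists w', [/\ forall u v, w' u v = w' v u,
    forall u v, 0 <= w' u v <= 1,
    forall u v, w u v = 0 -> w' u v = 0,
    forall v, \sum_u w' v u = \sum_u w v u
  & (#|fractional w'| < #|fractional w|)%N].
Proof.
move=> wC w0 w01 wV ltVF.
pose lt (u v : T) := (enum_rank u < enum_rank v)%N.
pose F := fractional w; pose Fl := [set e in F | lt e.1 e.2].
have inF u v : ((u, v) \in F) = (0 < w u v < 1) by rewrite inE.
have ltVFl : (#|V| < #|Fl|)%N.
  have FE : F = Fl :|: [set e | (e.2, e.1) \in Fl].
    apply/setP=> -[u v]; rewrite !inE /= [w v u]wC -andb_orr.
    have [->|uv] := eqVneq u v; first by rewrite w0 ltxx.
    suff -> : lt u v || lt v u by rewrite andbT.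
    by rewrite /lt -neq_ltn; apply: contraNneq uv => /ord_inj/enum_rank_inj->.
  have swapE : #|[set e : T * T | (e.2, e.1) \in Fl]| = #|Fl|.
    rewrite -[RHS](card_imset Fl (f := fun e => (e.2, e.1))) //; last first.
      by move=> [? ?] [? ?] [-> ->].
    congr #|pred_of_set _|; apply/setP=> -[u v]; rewrite inE /=.
    apply/idP/imsetP => [vu|[[x y] xy [-> ->]] //]; by exists (v, u).
  rewrite -(ltn_pmul2l (isT : 0 < 2)%N); apply: leq_trans ltVF _.
  rewrite -/F FE; apply: leq_trans (leq_card_setU _ _) _.
  by rewrite swapE addnn mul2n.
have [x [[e0 xe0] xS]] := @exists_dependency R {e | e \in Fl} {v | v \in V}
   (fun e s => ((val e).1 == val s)%:R + ((val e).2 == val s)%:R)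
   ltac:(by rewrite !card_sig).
pose y e := if insub e is Some e' then x e' else 0.
have yx e (eF : e \in Fl) : y e = x (Sub e eF) by rewrite /y insubT.
have y0 e : e \notin Fl -> y e = 0 by move=> eF; rewrite /y insubN.
pose z u v := y (u, v) + y (v, u).
have zC u v : z u v = z v u by rewrite /z addrC.
have zF u v : z u v != 0 -> (u, v) \in F.
  apply: contraNT => uvF; rewrite /z !y0 ?addr0 // inE negb_and; apply/orP;
    left.
    by move: uvF; rewrite !inF [w v u]wC.
  by [].
have zsum v : \sum_u z v u = 0.
  have [vV|vV] := boolP (v \in V); last first.
    rewrite big1 // => u _; apply/eqP; apply: contraNT vV => /zF.
    by rewrite inF => /andP[/gt_eqF/negbT/wV].
  rewrite -[RHS](xS (Sub v vV)).
  transitivity (\sum_e y e * ((e.1 == v)%:R + (e.2 == v)%:R)).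
    rewrite [RHS](eq_bigr (fun e => y (e.1, e.2) * ((e.1 == v)%:R + (e.2 ==
      v)%:R))); last by case.
    rewrite -(pair_bigA _ (fun a b => y (a, b) * ((a == v)%:R + (b == v)%:R)))
      /=.
    under [RHS]eq_bigr => a _ do
      under eq_bigr => b _ do rewrite mulrDr.
    under [RHS]eq_bigr => a _ do rewrite big_split /=.
    rewrite !big_split /=; congr (_ + _).
      rewrite [RHS](bigD1 v) //= [X in _ + X]big1 => [|a /negPf av].
        by rewrite addr0; apply: eq_bigr => b _; rewrite eqxx mulr1.
      by rewrite big1 // => b _; rewrite av mulr0.
    apply: eq_bigr => a _; rewrite (bigD1 v) //= eqxx mulr1 big1 ?addr0 //.
    by move=> b /negPf->; rewrite mulr0.
  rewrite (bigID [in Fl]) /= [X in _ + X]big1 ?addr0 => [|e /y0->];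
    last by rewrite mul0r.
  rewrite (reindex_onto val (insubd e0)) /= => [|e eF]; last by rewrite insubdK.
  apply: eq_big => [e|e _].
    by rewrite (valP e) valKd eqxx.
  by rewrite /y valK.
have [u1 [v1 z1]] : exists u v, z u v != 0.
  exists (val e0).1, (val e0).2;
    rewrite /z -surjective_pairing (yx _ (valP e0)).
  rewrite y0 ?addr0; last first.
    have := valP e0; rewrite !inE /= => /andP[_ l12].
    by rewrite negb_and orbC /lt -leqNgt ltnW.
  by suff -> : Sub (val e0) (valP e0) = e0 by []; apply: val_inj.
pose s (e : T * T) := if 0 < z e.1 e.2 then (1 - w e.1 e.2) / z e.1 e.2
                      else - w e.1 e.2 / z e.1 e.2.
have [[a b] /= zab smin] := @Order.TotalTheory.arg_minP _ _ _ (u1, v1)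
  (fun e => z e.1 e.2 != 0) s z1.
have sab : 0 <= s (a, b).
  rewrite /s /=; have /andP[w0' w1'] := w01 a b; case: ifP => zp.
    by apply: divr_ge0; [lra | exact: ltW].
  by rewrite -mulrNN -invrN opprK; apply: divr_ge0 => //; lra.
pose w' u v := w u v + s (a, b) * z u v.
have w'id u v : (u, v) \notin F -> w' u v = w u v.
  by move=> uvF; rewrite /w' (_ : z u v = 0) ?mulr0 ?addr0 //;
     apply/eqP; apply: contraNT uvF => /zF.
exists w'; split.
- by move=> u v; rewrite /w' wC zC.
- move=> u v; have /andP[w0' w1'] := w01 u v.
  have [zuv|zuv] := eqVneq (z u v) 0; first by rewrite /w' zuv mulr0 addr0 w0'.
  have := smin (u, v) zuv; rewrite {2}/s /= /w'; case: ifP => zp.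
    rewrite ler_pdivlMr // => sz.
    by have sz0 : 0 <= s (a, b) * z u v; [rewrite mulr_ge0 // ltW | apply/andP;
      split; lra].
  have zn : z u v < 0 by rewrite lt_neqAle zuv leNgt zp.
  rewrite ler_ndivlMr // => sz.
  have sz0 : s (a, b) * z u v <= 0 by rewrite mulr_ge0_le0 // ltW.
  by apply/andP; split; lra.
- by move=> u v wuv; rewrite w'id // inF wuv ltxx.
- by move=> v; rewrite big_split /= -mulr_sumr zsum mulr0 addr0.
apply: proper_card; apply/properP; split.
  apply/subsetP=> -[u v]; apply: contraTT => uvF.
  by move: (uvF); rewrite !inE /= w'id.
exists (a, b); first exact: zF.
rewrite inE /= /w' /s /=; case: ifP => zp; rewrite divfK //.
  by rewrite addrC subrK ltxx andbF.
by rewrite subrr ltxx.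
Qed.

Lemma rounding w :
  (forall u v, w u v = w v u) -> (forall v, w v v = 0) ->
  (forall u v, 0 <= w u v <= 1) -> (forall u v, w u v != 0 -> u \in V) ->
  exists b : rel T, [/\ symmetric b, forall u v, b u v -> w u v != 0,
    forall v, \sum_u (b v u)%:R <= \sum_u w v u
  & \sum_v \sum_u w v u <= \sum_v \sum_u (b v u)%:R + 2 * #|V|%:R].
Proof.
have [n] := ubnP #|fractional w|; elim: n w => // n IH w leF wC w0 w01 wV.
have [leFV|ltVF] := leqP #|fractional w| (2 * #|V|).
  have bw u v : (w u v == 1)%:R <= w u v.
    by have /andP[? ?] := w01 u v; case: eqP => // ->.
  exists (fun u v => w u v == 1); split.
  - by move=> u v /=; rewrite wC.
  - by move=> u v /eqP->; exact: oner_neq0.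
  - by move=> v; exact: ler_sum.
  apply: le_trans (_ : \sum_v \sum_u ((w v u == 1)%:R +
     ((v, u) \in fractional w)%:R) <= _).
    apply: ler_sum => v _; apply: ler_sum => u _; rewrite inE /=.
    have /andP[] := w01 v u; rewrite le0r le_eqVlt.
    case: (w v u =P 1) => [->|_ /=]; first by rewrite ltxx andbF addr0.
    by case/orP=> [/eqP->|->] wlt; rewrite ?ltxx ?wlt /= add0r // ltW.
  under eq_bigr do rewrite big_split /=.
  rewrite big_split /= lerD2l.
  rewrite (pair_bigA _ (fun v u => ((v, u) \in fractional w)%:R)) /=.
  rewrite -natr_sum -natrM ler_nat; apply: leq_trans leFV.
  rewrite -sum1_card [leqRHS]big_mkcond; apply: leq_sum => -[v u] _ /=.
  by case: ifP.
have [w' [w'C w'01 w'0 w'S ltF]] := fractional_reduce wC w0 w01 wV ltVF.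
have w'n u v : w' u v != 0 -> w u v != 0.
  by apply: contra_neq; exact: w'0.
have [||u v /w'n/wV //|b [bC bw bS bT]] := IH w' _ w'C _ w'01.
- by move: leF ltF; rewrite !ltnS => leF ltF; exact: leq_trans ltF leF.
- by move=> v; exact: w'0.
exists b; split=> //.
- by move=> u v /bw/w'n.
- by move=> v; rewrite -w'S.
- by under eq_bigr do rewrite -w'S.
Qed.

End Rounding.

(** * Almost regular subgraphs *)

Lemma almost_regular_weights (R : realType) (T : finType) (e : rel T) (k : R)
    (V : {set T}) (w : T -> T -> R) :
  irreflexive e -> 10 <= k ->
  (forall u v, w u v = w v u) -> (forall u v, 0 <= w u v <= expR (- 16) / 9) ->
  (forall u v, w u v != 0 -> [/\ u \in V, v \in V & e u v]) ->
  (forall v, \sum_u w v u <= k) ->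
  \sum_(v in V) (k - \sum_u w v u - k / 20) <= 0 ->
  exists (V' : {set T}) w', [/\ V' \subset V /\ (#|V| <= 2 * #|V'|)%N,
    (forall u v, w' u v = w' v u) /\ (forall u v, 0 <= w' u v <= 1),
    forall u v, w' u v != 0 -> [/\ u \in V', v \in V' & e u v],
    forall v, \sum_u w' v u <= k
  & k * #|V'|%:R - 10 * #|V'|%:R <= \sum_(v in V') \sum_u w' v u].
Proof.
move=> eirr k10 wC wm wV wk wD; pose m : R := expR (- 16) / 9.
have m0 : 0 <= m by rewrite divr_ge0 ?expR_ge0.
have m16 : m * expR 16 = 9^-1.
  by rewrite mulrAC -expRD addNr expR0 mul1r.
have st0 : capped_weights e k m V w (fun=> 0).
  by split=> // u v; rewrite addr0 expR0 mulr1.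
have [|V' [w' [a' [sV' [w'C w'm w'V w'k a'0] a'8 D' P']]]] :=
  reduce_deficit eirr k10 m0 _ st0; first by rewrite m16.
have VV' : (#|V| <= 2 * #|V'|)%N.
  rewrite -(ler_nat R) natrM -subr_ge0 -(pmulr_rge0 _ (_ : 0 < k / 20));
    last by lra.
  have P0 : potential k V w (fun=> 0) <= - (k / 20 * #|V|%:R).
    move: wD; rewrite sumrB sumr_const -mulr_natr => wD.
    rewrite /potential big_split /= sumr_const mulr0 sub0r mulNrn.
    by rewrite -[_ *+ _]mulr_natr; lra.
  have : - (k / 10 * #|V'|%:R) <= potential k V' w' a'.
    rewrite mulr_natr -mulNrn -sumr_const /potential; apply: ler_sum => v vV.
    have ka : 0 <= k / 4 * a' v by apply: mulr_ge0; [lra | exact: a'0].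
    by have := w'k v; lra.
  by move: P' P0; lra.
exists V', w'; split=> //.
- split=> // u v; have /andP[-> le1] := w'm u v => /=.
  have [->|/w'V[uV vV _]] := eqVneq (w' u v) 0; first exact: ler01.
  apply: le_trans le1 _; apply: le_trans (_ : m * expR 16 <= _);
    last by rewrite m16; lra.
  by rewrite ler_wpM2l // ler_expR; have := a'8 u uV; have := a'8 v vV; lra.
move: D'; rewrite /deficit sumrB sumr_const -mulr_natr => D'.
by move: VV'; rewrite -(ler_nat R) natrM; lra.
Qed.

Lemma degreeE (R : realType) (T : finType) (G : sgraph T) v :
  (degree G v)%:R = \sum_u (adj G v u)%:R :> R.
Proof.
rewrite /degree -sum1_card natr_sum big_mkcond; apply: eq_bigr => u _.
by rewrite inE; case: ifP.
Qed.

Lemma max_degree_le (R : realType) (T : finType) (G : sgraph T) (x : R) :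
  0 <= x -> (forall v, (degree G v)%:R <= x) -> (max_degree G)%:R <= x.
Proof.
move=> x0 Gx; rewrite /max_degree.
by elim/big_ind: _ => // m n mx nx; rewrite /maxn; case: ifP.
Qed.

Lemma initial_weights (R : realType) (T : finType) (G : sgraph T) (lam d m : R)
  :
  1 <= lam -> 0 < d -> 0 < m <= 1 -> 1600 <= m * d / lam ->
  (forall v, v \in vset G ->
     d <= (degree G v)%:R /\ (degree G v)%:R <= lam * d) ->
  let k := m * d / lam in
  exists (V : {set T}) (w : T -> T -> R), [/\ V \subset vset G /\ (forall u v,
    w u v = w v u),
    forall u v, 0 <= w u v <= m,
    forall u v, w u v != 0 -> [/\ u \in V, v \in V & adj G u v],
    forall v, \sum_u w v u <= k
  & \sum_(v in V) (k - \sum_u w v u - k / 20) <= 0 /\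
    #|vset G|%:R <= 2 * lam * #|V|%:R].
Proof.
move=> lam1 d0 /andP[m0 m1] kbig Gd k.
have lam0 : 0 < lam by lra.
have k0 : 0 < k by rewrite -/k in kbig; lra.
pose p v := (degree G v)%:R / (lam * d).
pose w u v := m / lam ^+ 2 * (adj G u v)%:R.
have ld0 : 0 < lam * d by rewrite mulr_gt0.
have deg0 v : v \notin vset G -> degree G v = 0%N.
  move=> vG; apply/eqP; rewrite cards_eq0; apply/eqP/setP => u; rewrite !inE.
  by apply: contraNF vG => /adj_vset.
have p01 v : 0 <= p v <= 1.
  rewrite divr_ge0 ?(ltW ld0) //= ler_pdivrMr // mul1r.
  have [/Gd[]//|/deg0->] := boolP (v \in vset G).
  exact: ltW.
have plam v : v \in vset G -> lam^-1 <= p v.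
  move=> /Gd[dv _]; rewrite ler_pdivlMr // mulrA mulVf ?gt_eqF // mul1r //.
have pk v : \sum_u w v u = k * p v.
  rewrite -mulr_sumr -degreeE /k /p; field.
  by rewrite !gt_eqF.
have wC u v : w u v = w v u by rewrite /w adj_sym.
have ml0 : 0 <= m / lam ^+ 2 by rewrite divr_ge0 ?sqr_ge0 ?ltW.
have p0 v : 0 <= p v by case/andP: (p01 v).
have wp u v : 0 <= w u v <= m * (p u * p v).
  have -> : 0 <= w u v by rewrite mulr_ge0.
  rewrite /w; case: (boolP (adj G u v)) => uv; last first.
    by rewrite mulr0; apply: mulr_ge0; [exact: ltW | exact: mulr_ge0].
  rewrite mulr1 -exprVn expr2; apply: ler_wpM2l; first exact: ltW.
  have lamV0 : 0 <= lam^-1 by rewrite invr_ge0 ltW.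
  apply: ler_pM => //; first exact: plam (adj_vset uv).
  by apply: plam; apply: (@adj_vset _ _ _ u); rewrite adj_sym.
have t0 : 0 < k / 40 by lra.
have w0 v : w v v = 0 by rewrite /w adj_irr mulr0.
have [V [w' [Vp w'C w'w w'V [w'k w'D]]]] :=
  sampling (fun=> - (k / 20)) k0 t0 wC w0 wp p01 pk.
have {w'D} D' : \sum_(v in V) (k - \sum_u w' v u - k / 20) <=
    - (k / 40 * (#|vset G|%:R / lam)).
  apply: le_trans w'D _; apply: le_trans (_ : \sum_v - (k / 40 * p v) <= _).
    apply: ler_sum => v _; have /andP[pv0 pv1] := p01 v.
    have -> : m / (2 * (k / 40)) * (k * p v * (1 - p v)) =
       20 * (m * (1 - p v) * p v) by field; rewrite gt_eqF.
    have mp : m * (1 - p v) * p v <= 1 * p v.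
      by apply: ler_wpM2r => //; apply: mulr_ile1 => //; lra.
    have kp : 1600 * p v <= k * p v by apply: ler_wpM2r.
    have -> : p v * (k / 40 / 2 + - (k / 20)) = - (3 / 80) * (k * p v) by field.
    by rewrite mulrAC; lra.
  rewrite sumrN lerN2 -mulr_sumr; apply: ler_wpM2l; first exact: ltW.
  rewrite -sum1_card natr_sum mulr_suml big_mkcond; apply: ler_sum => v _;
    case: ifP => // vG.
  by rewrite mul1r plam.
have posn : 0 <= k / 40 * (#|vset G|%:R / lam).
  by apply: mulr_ge0; [exact: ltW | apply: divr_ge0 => //; exact: ltW].
exists V, w'; split=> //.
- split=> //; apply/subsetP => v /Vp; apply: contraNT => /deg0 dv.
  by rewrite /p dv mul0r.
- move=> u v; have /andP[-> le1] := w'w u v => /=; apply: le_trans le1 _.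
  have [->|pp] := eqVneq (p u * p v) 0; first by rewrite invr0 mulr0 ltW.
  rewrite ler_pdivrMr; first by case/andP: (wp u v).
  by rewrite lt_def pp mulr_ge0.
- move=> u v w'uv; have /andP[-> ->] := w'V _ _ w'uv; split=> //.
  apply: contraNT w'uv => uv; have := w'w u v.
  by rewrite /w (negPf uv) mulr0 mul0r eq_le andbC.
split; first by lra.
have : - (k / 20 * #|V|%:R) <= - (k / 40 * (#|vset G|%:R / lam)).
  apply: le_trans D'; rewrite mulr_natr -mulNrn -sumr_const;
    apply: ler_sum => v _.
  by have := w'k v; lra.
rewrite lerN2 => h; have : #|vset G|%:R / lam <= 2 * #|V|%:R.
  rewrite -(ler_pM2l t0); apply: le_trans h _.
  by rewrite mulrA; lra.
by rewrite ler_pdivrMr // => /le_trans; apply; rewrite mulrAC.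
Qed.

Lemma spanning_matching (T : finType) (G : sgraph T) :
  exists H : sgraph T, [/\ subgraph H G, vset H = vset G,
    forall v, (degree H v <= 1)%N
  & (\sum_(v in vset G) degree G v <=
     2 * \sum_(v in vset G | degree H v != 0%N) degree G v)%N].
Proof.
pose matching (f : {ffun T -> T}) :=
  [forall x, (f (f x) == x) && ((f x == x) || adj G x (f x))].
pose moved (f : {ffun T -> T}) := #|[set x | f x != x]|.
have id_match : matching [ffun x => x].
  by apply/forallP => x; rewrite !ffunE !eqxx.
have [f /forallP fm fmax] := @arg_maxnP _ _ matching moved id_match.
have fK x : f (f x) = x by apply/eqP; case/andP: (fm x).
have fadj x : f x != x -> adj G x (f x).
  by move=> /negPf fx; have /andP[_] := fm x; rewrite fx.
have cover x y : adj G x y -> (f x != x) || (f y != y).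
  move=> xy; apply: contraT; rewrite negb_or !negbK => /andP[/eqP fx /eqP fy].
  have xny : x != y by apply: contraTneq xy => ->; rewrite adj_irr.
  pose g := [ffun z => if z == x then y else if z == y then x else f z].
  have gm : matching g.
    apply/forallP => z; rewrite !ffunE.
    have [->|zx] := eqVneq z x;
      first by rewrite (eq_sym y x) (negPf xny) !eqxx xy orbT.
    have [->|zy] := eqVneq z y;
      first by rewrite !eqxx [adj _ y x]adj_sym xy orbT.
    have -> : f z == x = false.
      by apply: contraNF zx => /eqP fz; rewrite -(fK z) fz fx.
    have -> : f z == y = false.
      by apply: contraNF zy => /eqP fz; rewrite -(fK z) fz fy.
    exact: fm.
  have : (moved g <= moved f)%N by exact: fmax.
  rewrite leqNgt => /negP[]; apply: proper_card.
  apply/properP; split.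
    apply/subsetP => z; rewrite !inE ffunE; have [->|zx] := eqVneq z x.
      by rewrite fx eqxx.
    by have [->|//] := eqVneq z y; rewrite fy eqxx.
  by exists x; rewrite !inE ?ffunE ?eqxx ?fx ?eqxx // eq_sym.
pose b x y := (f x == y) && (x != y).
have bsym : symmetric b.
  move=> x y; rewrite /b [y == x]eq_sym; congr (_ && _).
  by apply/eqP/eqP => <-; rewrite fK.
have birr : irreflexive b by move=> x; rewrite /b eqxx andbF.
have badj x y : b x y -> adj G x y.
  by case/andP => /eqP <- xf; apply: fadj; rewrite eq_sym.
pose H := SGraph bsym birr (fun x y xy => adj_vset (badj x y xy)) (vset_neq0 G).
exists H; split=> //.
  move=> v; rewrite -(cards1 (f v)); apply: subset_leq_card.
  by apply/subsetP => u; rewrite !inE => /andP[/eqP-> _].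
have Hmoved v : f v != v -> degree H v != 0%N.
  by move=> fv; rewrite cards_eq0; apply/set0Pn; exists (f v);
    rewrite inE /= /b eqxx eq_sym.
apply: leq_trans (_ : \sum_v \sum_u adj G v u * ((degree H v != 0) + (degree H
  u != 0)) <= _)%N.
  rewrite big_mkcond; apply: leq_sum => v _; case: ifP => // _.
  rewrite /degree -sum1_card big_mkcond; apply: leq_sum => u _; rewrite inE.
  case: ifP => // /cover /orP[] /Hmoved ->; first by rewrite mul1n.
  by rewrite mul1n addn1.
under eq_bigr => v _ do under eq_bigr => u _ do rewrite mulnDr.
under eq_bigr => v _ do rewrite big_split.
rewrite big_split /= [X in (_ + X)%N]exchange_big /= mul2n -addnn.
have E : (\sum_v \sum_u adj G v u * (degree H v != 0) <=
    \sum_(v in vset G | degree H v != 0) degree G v)%N.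
  rewrite [leqRHS]big_mkcond; apply: leq_sum => v _; rewrite -big_distrl /=.
  have [_|_] := boolP (degree H v != 0%N); last by rewrite muln0.
  rewrite muln1 andbT; case: ifPn => vG.
    by rewrite /degree -sum1_card [leqRHS]big_mkcond; apply: leq_sum => u _;
      rewrite inE; case: ifP.
  rewrite big1 // => u _; apply/eqP; rewrite eqb0; apply: contra vG;
    exact: adj_vset.
apply: leq_add => //; apply: leq_trans E; apply: leq_sum => v _.
by apply: leq_sum => u _; rewrite adj_sym.
Qed.

Lemma ler_div_exp (R : realFieldType) (lam x : R) (i j : nat) :
  1 <= lam -> 0 <= x -> (i <= j)%N -> x / lam ^+ j <= x / lam ^+ i.
Proof.
move=> lam1 x0 ij; apply: ler_wpM2l => //.
by rewrite lef_pV2 ?posrE ?exprn_gt0 ?(lt_le_trans ltr01) // ler_weXn2l.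
Qed.

Lemma dense_case (R : realType) (T : finType) (G : sgraph T) (lam d : R) :
  let k := expR (- 16) / 9 * d / lam in
  1 <= lam -> 0 < d -> 1600 <= k ->
  (forall v, v \in vset G ->
     d <= (degree G v)%:R /\ (degree G v)%:R <= lam * d) ->
  exists H : sgraph T, [/\ subgraph H G, k - 12 <= avg_degree R H,
    (max_degree H)%:R <= k & #|vset G|%:R <= 4 * lam * #|vset H|%:R].
Proof.
move=> k lam1 d0 kbig Gd; pose m : R := expR (- 16) / 9.
have e1 : expR (- 16) < 1 :> R by rewrite expR_lt1; lra.
have m01 : 0 < m <= 1.
  by rewrite divr_gt0 ?expR_gt0 //= ler_pdivrMr //; lra.
have [V [w [[VG wC] wm wV wk [wD GV]]]] := initial_weights lam1 d0 m01 kbig Gd.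
have k10 : 10 <= k by lra.
have [V' [w' [[V'V VV'] [w'C w'01] w'V w'k w'D]]] :=
  almost_regular_weights (adj_irr G) k10 wC wm wV wk wD.
have lam0 : 0 < lam by lra.
have GV' : #|vset G|%:R <= 4 * lam * #|V'|%:R.
  apply: le_trans GV _; rewrite -(ler_nat R) natrM in VV'.
  have -> : 4 * lam * #|V'|%:R = 2 * lam * (2 * #|V'|%:R) by ring.
  by apply: ler_wpM2l => //; lra.
have V'0 : V' != set0.
  apply: contraTneq GV' => ->; rewrite cards0 mulr0 -ltNge ltr0n card_gt0.
  exact: vset_neq0.
have w'0 v : w' v v = 0.
  by apply/eqP; apply: contraT => /w'V[_ _]; rewrite adj_irr.
have w'V1 u v : w' u v != 0 -> u \in V' by case/w'V.
have [b [bC bw bk bD]] := rounding w'C w'0 w'01 w'V1.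
have badj x y : b x y -> adj G x y by move/bw/w'V => [].
have birr : irreflexive b.
  by move=> x; apply/negP => /badj; rewrite adj_irr.
pose H := SGraph bC birr (fun x y bxy => w'V1 x y (bw x y bxy)) V'0.
have V'p : 0 < #|V'|%:R :> R by rewrite ltr0n card_gt0.
exists H; split=> //.
- by split=> //=; exact: subset_trans VG.
- rewrite /avg_degree ler_pdivlMr //=.
  have -> : \sum_(v in V') (degree H v)%:R = \sum_v \sum_u (b v u)%:R :> R.
    rewrite big_mkcond; apply: eq_bigr => v _; rewrite degreeE.
    case: ifPn => // vV'; rewrite big1 // => u _; case: (boolP (b v u)) => //.
    by move/bw/w'V1; rewrite (negPf vV').
  have le1 : \sum_(v in V') \sum_u w' v u <= \sum_v \sum_u w' v u.
    rewrite [leLHS]big_mkcond; apply: ler_sum => v _; case: ifP => // _.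
    by apply: sumr_ge0 => u _; case/andP: (w'01 v u).
  by rewrite mulrBl; lra.
apply: max_degree_le => [|v]; first by lra.
by rewrite degreeE; apply: le_trans (w'k v); exact: bk.
Qed.

Lemma sparse_case (R : realType) (T : finType) (G : sgraph T) (lam d : R) :
  1 <= lam -> 0 < d ->
  (forall v, v \in vset G ->
     d <= (degree G v)%:R /\ (degree G v)%:R <= lam * d) ->
  exists H : sgraph T, [/\ subgraph H G, (2 * lam)^-1 <= avg_degree R H,
    (max_degree H <= 1)%N & vset H = vset G].
Proof.
move=> lam1 d0 Gd; have [H [HG vHG H1 HD]] := spanning_matching G.
exists H; split=> //; last by apply/bigmax_leqP => v _; exact: H1.
have n0 : 0 < #|vset G|%:R :> R by rewrite ltr0n card_gt0 vset_neq0.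
rewrite /avg_degree vHG ler_pdivlMr // mulrC ler_pdivrMr; last by lra.
rewrite -(ler_pM2r d0); set s := \sum_(v in vset G) _.
apply: le_trans (_ : \sum_(v in vset G) (degree G v)%:R <= _).
  rewrite -sum1_card natr_sum mulr_suml; apply: ler_sum => v /Gd[dv _].
  by rewrite mul1r.
rewrite -natr_sum; apply: le_trans (_ : _ <= (2 * _)%:R) _.
  by rewrite ler_nat; exact: HD.
rewrite natrM natr_sum [leRHS](_ : _ = 2 * (s * (lam * d))); last by ring.
apply: ler_wpM2l => //; rewrite /s mulr_suml big_mkcondr /=.
apply: ler_sum => v /Gd[_ dv]; have := H1 v.
by case: (degree H v) => [|[|//]] _ /=; rewrite ?mul0r ?mul1r.
Qed.

Theorem theorem2p1 (R : realType) :
  exists c : R, 0 < c /\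
    forall (lam d : R), 1 <= lam -> 0 < d ->
    forall (T : finType) (G : sgraph T),
      (forall v : T, v \in vset G ->
         d <= (degree G v)%:R /\ (degree G v)%:R <= lam * d) ->
      exists d' : R, c * d / lam ^+ 3 <= d' /\
        exists H : sgraph T,
          [/\ subgraph H G,
              avg_degree R H = d',
              (max_degree H)%:R <= d' + 10 ^+ 8
            & c * #|vset G|%:R / lam ^+ 10 <= #|vset H|%:R].
Proof.
pose m : R := expR (- 16) / 9.
have m0 : 0 < m by rewrite divr_gt0 ?expR_gt0.
have m1 : m <= 1.
  have : expR (- 16) < 1 :> R by rewrite expR_lt1; lra.
  by rewrite ler_pdivrMr //; lra.
have big : 100 <= 10 ^+ 8 :> R.
  have -> : 100 = 10 ^+ 2 :> R by ring.
  by apply: ler_weXn2l => //; lra.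
exists (m / 3200); split=> [|lam d lam1 d0 T G Gd]; first by rewrite divr_gt0.
have lam0 : 0 < lam by lra.
have n0 : 0 <= m / 3200 * #|vset G|%:R by apply: mulr_ge0 => //; lra.
have cd0 : 0 <= m / 3200 * d by apply: mulr_ge0; lra.
have [kbig|ksmall] := lerP 1600 (m * d / lam).
  have [H [HG Havg Hmax HV]] := dense_case lam1 d0 kbig Gd.
  exists (avg_degree R H); split.
    apply: le_trans (ler_div_exp (i := 1) lam1 cd0 _) _ => //; rewrite expr1.
    have -> : m / 3200 * d / lam = m * d / lam / 3200 by ring.
    by move: kbig Havg; rewrite -/m; lra.
  exists H; split=> //; first by move: Havg Hmax; lra.
  apply: le_trans (ler_div_exp (i := 1) lam1 n0 _) _ => //; rewrite expr1.
  rewrite ler_pdivrMr //;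
    apply: le_trans (_ : m / 3200 * (4 * lam * #|vset H|%:R) <= _).
    by apply: ler_wpM2l => //; lra.
  have -> : m / 3200 * (4 * lam * #|vset H|%:R) = m / 800 * (#|vset H|%:R *
    lam) by field.
  by apply: ler_piMl; [apply: mulr_ge0 => //; lra | lra].
have [H [HG Havg Hmax HV]] := sparse_case lam1 d0 Gd.
exists (avg_degree R H); split.
  apply: le_trans (ler_div_exp (i := 2) lam1 cd0 _) _ => //.
  apply: le_trans Havg.
  have -> : m / 3200 * d / lam ^+ 2 = m * d / lam / (3200 * lam) by field;
    rewrite gt_eqF.
  have -> : (2 * lam)^-1 = 1600 / (3200 * lam) by field; rewrite gt_eqF.
  by apply: ler_wpM2r; [rewrite invr_ge0; lra | exact: ltW].
exists H; split=> //.
  have : (max_degree H)%:R <= 1 :> R by rewrite (ler_nat R _ 1).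
  have : 0 <= (2 * lam)^-1 by rewrite invr_ge0; lra.
  by move: Havg; lra.
rewrite HV; apply: le_trans (ler_div_exp (i := 0) lam1 n0 _) _ => //.
by rewrite expr0 divr1; apply: ler_piMl => //; lra.
Qed.
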